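(* Let $((A,[\ ,\ ]_A,\cdot_A),\mathfrak B,P)$ be a quadratic Rota-Baxter Poisson algebra of weight $\lambda\neq0$, and let $I_{\mathfrak B}:A^*\to A$ be the linear isomorphism induced by $\mathfrak B$, i.e. $\langle I_{\mathfrak B}^{-1}(a),b\rangle=\mathfrak B(a,b)$ for all $a,b\in A$. Let $r\in A\otimes A$ be the 2-tensor form of $P\circ I_{\mathfrak B}$, defined by $\langle r,x^*\otimes y^*\rangle=\langle(P\circ I_{\mathfrak B})(x^* ),y^*\rangle$ for all $x^*,y^*\in A^*$. Then $r$ is a solution of the Poisson Yang-Baxter equation in $(A,[\ ,\ ]_A,\cdot_A)$ and gives rise to a factorizable Poisson bialgebra $(A,[\ ,\ ]_A,\cdot_A,\delta_r,\Delta_r)$.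
   Context: All vector spaces are finite-dimensional over a field $\mathbb K$ of characteristic $0$; algebras need not be unital. A Poisson algebra $(A,[\ ,\ ]_A,\cdot_A)$ is a Lie algebra and a commutative associative algebra on the same space with $[a,b\cdot_A c]_A=[a,b]_A\cdot_A c+b\cdot_A[a,c]_A$. Write $\mathrm{ad}(a)b=[a,b]_A$, $L(a)b=a\cdot_A b$. Quadratic Rota-Baxter Poisson algebra of weight $\lambda\in\mathbb K$: a Poisson algebra with a nondegenerate symmetric bilinear form $\mathfrak B$ that is invariant ($\mathfrak B([a,b]_A,c)=\mathfrak B(a,[b,c]_A)$, $\mathfrak B(a\cdot_A b,c)=\mathfrak B(a,b\cdot_A c)$) and a linear map $P:A\to A$ that is a Rota-Baxter operator of weight $\lambda$: $[P(a),P(b)]_A=P([P(a),b]_A+[a,P(b)]_A+\lambda[a,b]_A)$, $P(a)\cdot_A P(b)=P(P(a)\cdot_A b+a\cdot_A P(b)+\lambda a\cdot_A b)$, such that $\mathfrak B(a,P(b))+\mathfrak B(P(a),b)+\lambda\mathfrak B(a,b)=0$ for all $a,b\in A$. Poisson bialgebra: a Poisson algebra with linear maps $\delta,\Delta:A\to A\otimes A$ such that the dual operations $\langle[x^*,y^*]_{A^*},a\rangle=\langle\delta(a),x^*\otimes y^*\rangle$, $\langle x^*\cdot_{A^*}y^*,a\rangle=\langle\Delta(a),x^*\otimes y^*\rangle$ make $A^*$ a Poisson algebra and, for all $a,b\in A$: $\delta([a,b]_A)=(\mathrm{ad}(a)\otimes\mathrm{id}+\mathrm{id}\otimes\mathrm{ad}(a))\delta(b)-(\mathrm{ad}(b)\otimes\mathrm{id}+\mathrm{id}\otimes\mathrm{ad}(b))\delta(a)$;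 $\Delta(a\cdot_A b)=(L(a)\otimes\mathrm{id})\Delta(b)+(\mathrm{id}\otimes L(b))\Delta(a)$; $\delta(a\cdot_A b)=(L(a)\otimes\mathrm{id})\delta(b)+(L(b)\otimes\mathrm{id})\delta(a)+(\mathrm{id}\otimes\mathrm{ad}(a))\Delta(b)+(\mathrm{id}\otimes\mathrm{ad}(b))\Delta(a)$; $\Delta([a,b]_A)=(\mathrm{ad}(a)\otimes\mathrm{id}+\mathrm{id}\otimes\mathrm{ad}(a))\Delta(b)+(L(b)\otimes\mathrm{id}-\mathrm{id}\otimes L(b))\delta(a)$. For $r=\sum_i a_i\otimes b_i$ put $\delta_r(a)=(\mathrm{id}\otimes\mathrm{ad}(a)+\mathrm{ad}(a)\otimes\mathrm{id})(r)$, $\Delta_r(a)=(\mathrm{id}\otimes L(a)-L(a)\otimes\mathrm{id})(r)$. $r$ is a solution of the Poisson Yang-Baxter equation if $\mathbf C(r)=\mathbf A(r)=0$, where $\mathbf C(r)=\sum_{i,j}([a_i,a_j]_A\otimes b_i\otimes b_j+a_i\otimes a_j\otimes[b_i,b_j]_A+a_i\otimes[b_i,a_j]_A\otimes b_j)$, $\mathbf A(r)=\sum_{i,j}(a_i\cdot_A a_j\otimes b_i\otimes b_j+a_i\otimes a_j\otimes b_i\cdot_A b_j-a_i\otimes a_j\cdot_A b_i\otimes b_j)$. $s\in A\otimes A$ is $(\mathrm{ad},L)$-invariant if $(\mathrm{ad}(a)\otimes\mathrm{id}+\mathrm{id}\otimes\mathrm{ad}(a))(s)=0=(L(a)\otimes\mathrm{id}-\mathrm{id}\otimes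 L(a))(s)$ for all $a\in A$. If $r$ solves the Poisson Yang-Baxter equation and its symmetric part $\frac12(r+\tau(r))$ ($\tau$ the flip) is $(\mathrm{ad},L)$-invariant, then $(A,[\ ,\ ]_A,\cdot_A,\delta_r,\Delta_r)$ is a Poisson bialgebra (known), called quasi-triangular; it is factorizable if moreover the symmetric part of $r$ is nondegenerate, i.e. $I_r=r_+-r_-:A^*\to A$ is a linear isomorphism, where $\langle r_+(x^* ),y^*\rangle=-\langle x^*,r_-(y^* )\rangle=\langle r,x^*\otimes y^*\rangle$. *)

(* Defs.v *)
From HB Require Import structures.
From mathcomp Require Import all_boot all_order all_algebra.
Set Implicit Arguments.
Unset Strict Implicit.
Unset Printing Implicit Defensive.
Import GRing.Theory.
Local Open Scope ring_scope.

Definition dual (K : fieldType) (U : vectType K) : vectType K := 'Hom(U, K^o).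

(* Bilinear maps U x V -> W, in curried form; in particular, for f : bilop A,
   f a : 'End(A) is the left multiplication operator b |-> f a b. *)
Definition bilmap (K : fieldType) (U V W : vectType K) : vectType K :=
  'Hom(U, 'Hom(V, W)).
Definition bilop (K : fieldType) (A : vectType K) : vectType K := bilmap A A A.
Definition bilform (K : fieldType) (A : vectType K) : vectType K :=
  bilmap A A K^o.

(* The tensor product of finite-dimensional spaces is realised as
   Hom(U^*, V), with (u ⊗ v)(x) = <x, u> v. The lemmas tens_bilinear,
   tlift_linear, tlift_tens and tlift_uniq are its universal property; all
   later definitions only use ⊗ and tlift. *)
Definition tens (K : fieldType) (U V : vectType K) : vectType K :=
  'Hom(dual U, V).

Definition pure (K : fieldType) (U V : vectType K) (u : U) (v : V) : tens U V :=
  linfun (fun x : dual U => (x u : K) *: v).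

Declare Scope tens_scope.
Delimit Scope tens_scope with T.
Notation "u ⊗ v" := (pure u v) (at level 35, right associativity) : tens_scope.
Local Open Scope tens_scope.

Definition coordf (K : fieldType) (U : vectType K) (i : 'I_(\dim {:U})) :
    dual U :=
  linfun (coord (vbasis {:U}) i : U -> K^o).

(* tlift f is the linear map on tens U V induced by the bilinear map f, that is
   \sum_k u_k ⊗ v_k |-> \sum_k f u_k v_k; it is evaluated on the decomposition
   t = \sum_i e_i ⊗ t(e_i^* ) along a basis (e_i) of U (lemma tens_decomp). *)
Definition tlift (K : fieldType) (U V : vectType K) (W : lmodType K)
    (f : U -> V -> W) (t : tens U V) : W :=
  \sum_(i < \dim {:U}) f (vbasis {:U})`_i (t (coordf i)).

Section TensorTheory.
Variable K : fieldType.

Definition bilin (U V : vectType K) (W : lmodType K) (f : U -> V -> W) : Prop :=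
  (forall u, linear (f u)) /\ (forall v, linear (f^~ v)).

Lemma linear_linfunE (U V : vectType K) (f : U -> V) :
  linear f -> linfun f =1 f.
Proof.
move=> lf u.
pose ff : {linear U -> V} := HB.pack f (GRing.isLinear.Build K U V *:%R f lf).
exact: (lfunE ff).
Qed.

Lemma lfun_linear (U V : vectType K) (f : 'Hom(U, V)) : linear f.
Proof. exact: linearP. Qed.

Lemma linear_sum_of (U V : lmodType K) (f : U -> V) (lf : linear f)
  (I : finType) (F : I -> U) : f (\sum_i F i) = \sum_i f (F i).
Proof.
pose ff : {linear U -> V} := HB.pack f (GRing.isLinear.Build K U V *:%R f lf).
exact: (linear_sum ff).
Qed.

Lemma linear_scale_of (U V : lmodType K) (f : U -> V) (lf : linear f)
  k u : f (k *: u) = k *: f u.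
Proof.
pose ff : {linear U -> V} := HB.pack f (GRing.isLinear.Build K U V *:%R f lf).
exact: (linearZ_LR ff).
Qed.

Lemma pureE (U V : vectType K) (u : U) (v : V) (x : dual U) :
  (u ⊗ v) x = (x u : K) *: v.
Proof.
rewrite /pure (linear_linfunE (f := fun x : dual U => (x u : K) *: v)) // => k y z.
by rewrite add_lfunE scale_lfunE scalerDl scalerA.
Qed.

Lemma tens_bilinear (U V : vectType K) : bilin (@pure K U V).
Proof.
split=> [u|v] k y z; apply/lfunP=> x; rewrite add_lfunE scale_lfunE !pureE.
  by rewrite scalerDr !scalerA mulrC.
by rewrite linearP /= scalerDl scalerA.
Qed.

Lemma coordfE (U : vectType K) (u : U) i :
  coordf i u = coord (vbasis {:U}) i u.
Proof. exact: lfunE. Qed.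

Lemma tlift_linear (U V : vectType K) (W : lmodType K) (f : U -> V -> W) :
  bilin f -> linear (tlift f).
Proof.
move=> [fr _] k s t; rewrite /tlift scaler_sumr -big_split.
by apply: eq_bigr => i _; rewrite add_lfunE scale_lfunE fr.
Qed.

Lemma tlift_tens (U V : vectType K) (W : lmodType K) (f : U -> V -> W) :
  bilin f -> forall u v, tlift f (u ⊗ v) = f u v.
Proof.
move=> [fr fl] u v; rewrite [in RHS](coord_vbasis (memvf u)).
rewrite (linear_sum_of (fl v)) /tlift; apply: eq_bigr => i _.
by rewrite pureE coordfE (linear_scale_of (fr _)) (linear_scale_of (fl v)).
Qed.

Lemma tlift_sum (U V : vectType K) (W : lmodType K) (f : U -> V -> W) :
  bilin f -> forall (I : finType) (u : I -> U) (v : I -> V),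
  tlift f (\sum_k u k ⊗ v k) = \sum_k f (u k) (v k).
Proof.
move=> bf I u v; rewrite (linear_sum_of (tlift_linear bf)).
by apply: eq_bigr => k _; rewrite tlift_tens.
Qed.

Lemma tens_decomp (U V : vectType K) (t : tens U V) :
  t = \sum_(i < \dim {:U}) (vbasis {:U})`_i ⊗ t (coordf i).
Proof.
apply/lfunP=> x; rewrite sum_lfunE.
transitivity (t (\sum_(i < \dim {:U}) (x (vbasis {:U})`_i : K) *:
                 coordf i)).
  congr (t _); apply/lfunP=> u; rewrite sum_lfunE.
  rewrite [in LHS](coord_vbasis (memvf u)) linear_sum; apply: eq_bigr => i _.
  by rewrite scale_lfunE coordfE linearZ; exact: mulrC.
by rewrite linear_sum; apply: eq_bigr => i _; rewrite pureE linearZ.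
Qed.

Lemma tlift_uniq (U V : vectType K) (W : lmodType K) (f : U -> V -> W)
    (g : tens U V -> W) :
  linear g -> (forall u v, g (u ⊗ v) = f u v) -> g =1 tlift f.
Proof.
move=> lg gE t; rewrite [in LHS](tens_decomp t) (linear_sum_of lg).
by apply: eq_bigr => i _; rewrite gE.
Qed.

End TensorTheory.

Section TensorMaps.
Variable K : fieldType.

(* <t, s> for t in U ⊗ V and s in U^* ⊗ V^*. *)
Definition tpair (U V : vectType K) (t : tens U V)
    (s : tens (dual U) (dual V)) : K :=
  tlift (fun u v => tlift (fun (x : dual U) (y : dual V) =>
    (x u : K) * (y v : K) : K^o) s) t.

Definition tmap (U V U' V' : vectType K) (f : 'Hom(U, U')) (g : 'Hom(V, V')) :
    tens U V -> tens U' V' :=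
  tlift (fun u v => f u ⊗ g v).

Definition tflip (U V : vectType K) : tens U V -> tens V U :=
  tlift (fun u v => v ⊗ u).

Lemma bilin_prod (U V : vectType K) (u : U) (v : V) :
  bilin (fun (x : dual U) (y : dual V) => (x u : K) * (y v : K) : K^o).
Proof.
split=> [x|y] k b c; rewrite add_lfunE scale_lfunE.
  by rewrite mulrDr scalerAr.
by rewrite mulrDl scalerAl.
Qed.

Lemma tpairE (U V : vectType K) (t : tens U V) (x : dual U) (y : dual V) :
  tpair t (x ⊗ y) = y (t x).
Proof.
rewrite [t in RHS]tens_decomp sum_lfunE linear_sum.
apply: eq_bigr => i _; rewrite pureE linearZ.
exact: (tlift_tens (bilin_prod _ _)).
Qed.

Lemma tpair_tens (U V : vectType K) (u : U) (v : V) (x : dual U) (y : dual V) :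
  tpair (u ⊗ v) (x ⊗ y) = (x u : K) * (y v : K).
Proof. by rewrite tpairE pureE linearZ. Qed.

Lemma tmap_bilin (U V U' V' : vectType K) (f : 'Hom(U, U')) (g : 'Hom(V, V')) :
  bilin (fun u v => f u ⊗ g v).
Proof.
have [pr pl] := @tens_bilinear K U' V'.
by split=> [u|v] k b c; rewrite lfun_linear; [apply: pr | apply: (pl (g v))].
Qed.

Lemma tmap_linear (U V U' V' : vectType K) (f : 'Hom(U, U')) (g : 'Hom(V, V')) :
  linear (tmap f g).
Proof. exact: tlift_linear (tmap_bilin f g). Qed.

Lemma tmap_tens (U V U' V' : vectType K) (f : 'Hom(U, U')) (g : 'Hom(V, V'))
  (u : U) (v : V) : tmap f g (u ⊗ v) = f u ⊗ g v.
Proof. exact: tlift_tens (tmap_bilin f g) u v. Qed.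

Lemma tflip_tens (U V : vectType K) (u : U) (v : V) : tflip (u ⊗ v) = v ⊗ u.
Proof.
have [pr pl] := @tens_bilinear K V U.
by apply: (tlift_tens (f := fun u v => v ⊗ u)); split=> [a|a] k b c;
  [apply: (pl a) | apply: pr].
Qed.

End TensorMaps.

Section Poisson.
Variable K : fieldType.

Record is_poisson (A : vectType K) (br mul : bilop A) : Prop := IsPoisson {
  poisson_alt : forall a, br a a = 0;
  poisson_jacobi : forall a b c,
    br a (br b c) + br b (br c a) + br c (br a b) = 0;
  poisson_mulC : forall a b, mul a b = mul b a;
  poisson_mulA : forall a b c, mul a (mul b c) = mul (mul a b) c;
  poisson_leibniz : forall a b c,
    br a (mul b c) = mul (br a b) c + mul b (br a c) }.

Variable A : vectType K.
Implicit Types (br mul : bilop A) (B : bilform A) (P : 'End(A)) (lam : K).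

Definition nondegenerate B : Prop := forall a, (forall b, B a b = 0) -> a = 0.

Definition rota_baxter lam (op : bilop A) P : Prop := forall a b,
  op (P a) (P b) = P (op (P a) b + op a (P b) + lam *: op a b).

Record quadratic_rota_baxter_poisson br mul B P lam : Prop :=
  QuadraticRotaBaxterPoisson {
  qrb_poisson : is_poisson br mul;
  qrb_sym : forall a b, B a b = B b a;
  qrb_nondeg : nondegenerate B;
  qrb_inv_br : forall a b c, B (br a b) c = B a (br b c);
  qrb_inv_mul : forall a b c, B (mul a b) c = B a (mul b c);
  qrb_rb_br : rota_baxter lam br P;
  qrb_rb_mul : rota_baxter lam mul P;
  qrb_compat : forall a b, B a (P b) + B (P a) b + lam *: B a b = 0 }.

(* I_B : A^* -> A; note that B, in curried form, is I_B^{-1}. *)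
Definition form_iso B : 'Hom(dual A, A) := (B^-1)%VF.

Lemma dim_dual (U : vectType K) : dim (dual U) = dim U.
Proof. by rewrite /dim /= muln1. Qed.

Lemma form_isoP B : nondegenerate B ->
  cancel B (form_iso B) /\ cancel (form_iso B) B.
Proof.
move=> ndB.
have k0 : lker B == 0%VS.
  rewrite -subv0; apply/subvP=> a; rewrite memv_ker memv0 => /eqP Ba.
  by apply/eqP/ndB=> b; rewrite Ba zero_lfunE.
split=> [|x]; first exact: lker0_lfunK.
suff lf : limg B = fullv by rewrite limg_lfunVK // lf memvf.
apply/eqP; rewrite eqEdim subvf /= limg_dim_eq ?(eqP k0) ?capv0 //.
by rewrite !dimvf dim_dual leqnn.
Qed.

(* The operation on A^* dual to d : A -> A ⊗ A. *)
Definition dual_op (d : 'Hom(A, tens A A)) : bilop (dual A) :=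
  linfun (fun x => linfun (fun y : dual A =>
    linfun (fun a => tpair (d a) (x ⊗ y) : K^o) : dual A)
    : 'Hom(dual A, dual A)).

Lemma dual_opE d (x y : dual A) a : dual_op d x y a = tpair (d a) (x ⊗ y).
Proof.
pose f3 (x y : dual A) := fun a => tpair (d a) (x ⊗ y) : K^o.
have E3 x' y' : linfun (f3 x' y') =1 f3 x' y'.
  by apply: linear_linfunE => k b c; rewrite /f3 !tpairE lfun_linear add_lfunE scale_lfunE lfun_linear.
pose f2 (x : dual A) := fun y : dual A => linfun (f3 x y) : dual A.
have E2 x' : linfun (f2 x') =1 f2 x'.
  apply: linear_linfunE => k b c; apply/lfunP=> a'.
  by rewrite add_lfunE scale_lfunE !E3 /f3 !tpairE add_lfunE scale_lfunE.
have -> : dual_op d x = linfun (f2 x).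
  rewrite /dual_op -/(f2 _).
  apply: (linear_linfunE (f := fun x => linfun (f2 x))) => k b c.
  apply/lfunP=> y'; rewrite add_lfunE scale_lfunE !E2; apply/lfunP=> a'.
  by rewrite add_lfunE scale_lfunE !E3 /f3 !tpairE !lfun_linear.
by rewrite E2 E3.
Qed.

Record is_poisson_bialgebra br mul (delta Delta : 'Hom(A, tens A A)) : Prop :=
  IsPoissonBialgebra {
  pbi_poisson : is_poisson br mul;
  pbi_dual_poisson : is_poisson (dual_op delta) (dual_op Delta);
  pbi_delta_br : forall a b, delta (br a b) =
    (tmap (br a) \1%VF (delta b) + tmap \1%VF (br a) (delta b))
    - (tmap (br b) \1%VF (delta a) + tmap \1%VF (br b) (delta a));
  pbi_Delta_mul : forall a b, Delta (mul a b) =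
    tmap (mul a) \1%VF (Delta b) + tmap \1%VF (mul b) (Delta a);
  pbi_delta_mul : forall a b, delta (mul a b) =
    tmap (mul a) \1%VF (delta b) + tmap (mul b) \1%VF (delta a)
    + tmap \1%VF (br a) (Delta b) + tmap \1%VF (br b) (Delta a);
  pbi_Delta_br : forall a b, Delta (br a b) =
    (tmap (br a) \1%VF (Delta b) + tmap \1%VF (br a) (Delta b))
    + (tmap (mul b) \1%VF (delta a) - tmap \1%VF (mul b) (delta a)) }.

Implicit Type r : tens A A.

Definition delta_of br r : 'Hom(A, tens A A) :=
  linfun (fun a => tmap \1%VF (br a) r + tmap (br a) \1%VF r).

Definition Delta_of mul r : 'Hom(A, tens A A) :=
  linfun (fun a => tmap \1%VF (mul a) r - tmap (mul a) \1%VF r).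

Lemma tmap_linearr (op : bilop A) r : linear (fun a => tmap \1%VF (op a) r).
Proof.
move=> k b c; rewrite /tmap /tlift scaler_sumr -big_split; apply: eq_bigr => i _.
rewrite lfun_linear add_lfunE scale_lfunE.
by have [pr _] := @tens_bilinear K A A; apply: pr.
Qed.

Lemma tmap_linearl (op : bilop A) r : linear (fun a => tmap (op a) \1%VF r).
Proof.
move=> k b c; rewrite /tmap /tlift scaler_sumr -big_split; apply: eq_bigr => i _.
rewrite lfun_linear add_lfunE scale_lfunE.
by have [_ pl] := @tens_bilinear K A A; apply: (pl (\1%VF _)).
Qed.

Lemma delta_ofE br r a :
  delta_of br r a = tmap \1%VF (br a) r + tmap (br a) \1%VF r.
Proof.
apply: (linear_linfunE
  (f := fun a => tmap \1%VF (br a) r + tmap (br a) \1%VF r)) => k b c.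
by rewrite tmap_linearr tmap_linearl scalerDr addrACA.
Qed.

Lemma Delta_ofE mul r a :
  Delta_of mul r a = tmap \1%VF (mul a) r - tmap (mul a) \1%VF r.
Proof.
apply: (linear_linfunE
  (f := fun a => tmap \1%VF (mul a) r - tmap (mul a) \1%VF r)) => k b c.
by rewrite tmap_linearr tmap_linearl scalerBr opprD addrACA.
Qed.

(* The two nested tlift r stand for the sum over i and j in which
   r = \sum_i a_i ⊗ b_i and r = \sum_j a'_j ⊗ b'_j (lemmas C_ofE and A_ofE). *)
Definition C_of br r : tens A (tens A A) :=
  tlift (fun a b => tlift (fun a' b' =>
    br a a' ⊗ (b ⊗ b') + a ⊗ (a' ⊗ br b b') + a ⊗ (br b a' ⊗ b')) r) r.

Definition A_of mul r : tens A (tens A A) :=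
  tlift (fun a b => tlift (fun a' b' =>
    mul a a' ⊗ (b ⊗ b') + a ⊗ (a' ⊗ mul b b') - a ⊗ (mul a' b ⊗ b')) r) r.

Lemma tlift_double (W : lmodType K) (F : A -> A -> A -> A -> W) :
  (forall a b, bilin (F a b)) ->
  (forall a' b', bilin (fun a b => F a b a' b')) ->
  forall (I : finType) (a b : I -> A),
  let r := \sum_i a i ⊗ b i in
  tlift (fun x y => tlift (F x y) r) r
  = \sum_i \sum_j F (a i) (b i) (a j) (b j).
Proof.
move=> b1 b2 I a b r; rewrite tlift_sum; last first.
  split=> [u|v] k x y; rewrite !(tlift_sum (b1 _ _)) scaler_sumr -big_split;
    apply: eq_bigr => j _.
    by case: (b2 (a j) (b j)) => fr _; rewrite fr.
  by case: (b2 (a j) (b j)) => _ fl; rewrite (fl v).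
by apply: eq_bigr => i _; rewrite tlift_sum.
Qed.

Lemma bilinD (U V : vectType K) (W : lmodType K) (f g : U -> V -> W) :
  bilin f -> bilin g -> bilin (fun u v => f u v + g u v).
Proof.
move=> [fr fl] [gr gl]; split=> [u|v] k x y.
  by rewrite fr gr scalerDr addrACA.
by rewrite (fl v) (gl v) scalerDr addrACA.
Qed.

Lemma bilinN (U V : vectType K) (W : lmodType K) (f : U -> V -> W) :
  bilin f -> bilin (fun u v => - f u v).
Proof.
move=> [fr fl]; split=> [u|v] k x y; first by rewrite fr opprD scalerN.
by rewrite (fl v) opprD scalerN.
Qed.

Lemma purePr (U V : vectType K) (u : U) k (v w : V) :
  u ⊗ (k *: v + w) = k *: (u ⊗ v) + u ⊗ w.
Proof. by have [pr _] := @tens_bilinear K U V; apply: pr. Qed.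

Lemma purePl (U V : vectType K) (v : V) k (u w : U) :
  (k *: u + w) ⊗ v = k *: (u ⊗ v) + w ⊗ v.
Proof. by have [_ pl] := @tens_bilinear K U V; apply: (pl v). Qed.

Lemma bilopPl (op : bilop A) k a b c :
  op (k *: a + b) c = k *: op a c + op b c.
Proof. by rewrite lfun_linear add_lfunE scale_lfunE. Qed.

Lemma C_ofE br (I : finType) (a b : I -> A) :
  C_of br (\sum_i a i ⊗ b i) = \sum_i \sum_j
    (br (a i) (a j) ⊗ (b i ⊗ b j) + a i ⊗ (a j ⊗ br (b i) (b j))
     + a i ⊗ (br (b i) (a j) ⊗ b j)).
Proof.
apply: (tlift_double (F := fun a b a' b' => br a a' ⊗ (b ⊗ b')
  + a ⊗ (a' ⊗ br b b') + a ⊗ (br b a' ⊗ b'))) => x y;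
by apply: bilinD; [apply: bilinD|]; split=> ? ? ? ?;
  rewrite ?bilopPl ?lfun_linear ?(purePr, purePl).
Qed.

Lemma A_ofE mul (I : finType) (a b : I -> A) :
  A_of mul (\sum_i a i ⊗ b i) = \sum_i \sum_j
    (mul (a i) (a j) ⊗ (b i ⊗ b j) + a i ⊗ (a j ⊗ mul (b i) (b j))
     - a i ⊗ (mul (a j) (b i) ⊗ b j)).
Proof.
apply: (tlift_double (F := fun a b a' b' => mul a a' ⊗ (b ⊗ b')
  + a ⊗ (a' ⊗ mul b b') - a ⊗ (mul a' b ⊗ b'))) => x y;
by apply: bilinD; [apply: bilinD|apply: bilinN]; split=> ? ? ? ?;
  rewrite ?bilopPl ?lfun_linear ?(purePr, purePl).
Qed.

Definition poisson_YBE br mul r : Prop := C_of br r = 0 /\ A_of mul r = 0.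

Definition ad_L_invariant br mul (s : tens A A) : Prop := forall a,
  tmap (br a) \1%VF s + tmap \1%VF (br a) s = 0 /\
  tmap (mul a) \1%VF s - tmap \1%VF (mul a) s = 0.

Definition sym_part r : tens A A := (2%:R : K)^-1 *: (r + tflip r).

(* <r_+(x), y> = <r, x ⊗ y> = - <x, r_-(y)>: lemmas r_plusE and r_minusE. *)
Definition r_plus r : 'Hom(dual A, A) :=
  linfun (fun x : dual A => tlift (fun a b => (x a : K) *: b) r).

Definition r_minus r : 'Hom(dual A, A) :=
  linfun (fun y : dual A => - tlift (fun a b => (y b : K) *: a) r).

Lemma r_plusE r (x y : dual A) : y (r_plus r x) = tpair r (x ⊗ y).
Proof.
rewrite (linear_linfunE
  (f := fun x : dual A => tlift (fun a b => (x a : K) *: b) r)); last first.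
  move=> k b c; rewrite /tlift scaler_sumr -big_split; apply: eq_bigr => i _.
  by rewrite add_lfunE scale_lfunE scalerDl scalerA.
rewrite tpairE [in RHS](tens_decomp r) sum_lfunE.
by congr (y _); apply: eq_bigr => i _; rewrite pureE.
Qed.

Lemma r_minusE r (x y : dual A) : x (r_minus r y) = - tpair r (x ⊗ y).
Proof.
rewrite (linear_linfunE
  (f := fun y : dual A => - tlift (fun a b => (y b : K) *: a) r)); last first.
  move=> k b c; rewrite /tlift scalerN -opprD scaler_sumr -big_split.
  congr (- _); apply: eq_bigr => i _.
  by rewrite add_lfunE scale_lfunE scalerDl scalerA.
rewrite tpairE [in RHS](tens_decomp r) sum_lfunE !linearN; congr (- _).
rewrite !linear_sum; apply: eq_bigr => i _; rewrite pureE !linearZ; exact: mulrC.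
Qed.

Definition quasi_triangular br mul r : Prop :=
  [/\ is_poisson_bialgebra br mul (delta_of br r) (Delta_of mul r),
      poisson_YBE br mul r
    & ad_L_invariant br mul (sym_part r)].

Definition factorizable br mul r : Prop :=
  quasi_triangular br mul r /\ bijective (r_plus r - r_minus r).

End Poisson.

(* Main.v *)
(* Read an element t of A ⊗ A as the endomorphism a |-> t (B a). Then r becomes
   P, its flip becomes - P - lam by compatibility of P with B, and hence the
   symmetric part and I_r are multiples of the identity and of I_B. The
   Yang-Baxter equations turn into the Rota-Baxter identities for P, the
   operations dual to delta_r and Delta_r are carried by B to the descendent
   operations a * b |-> P a * b + a * P b + lam (a * b), and the compatibility
   conditions of a bialgebra follow from the Poisson identities alone. *)
Require Import Defs.
From mathcomp Require Import all_boot all_order all_algebra.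
From mathcomp Require Import ring.
Set Implicit Arguments.
Unset Strict Implicit.
Unset Printing Implicit Defensive.
Import GRing.Theory.
Local Open Scope ring_scope.
Local Open Scope tens_scope.

(** * Tensors as linear maps out of the dual space *)

Section Tensors.
Variable K : fieldType.
Implicit Types U V : vectType K.

(** Turns vector identities into scalar ones, to which [ring] applies. *)
Lemma dual_ext U (u v : U) : (forall x : dual U, x u = x v) -> u = v.
Proof.
move=> uv; rewrite (coord_vbasis (memvf u)) (coord_vbasis (memvf v)).
by apply: eq_bigr => i _; rewrite -!coordfE uv.
Qed.

Lemma tmapE U V U' V' (f : 'Hom(U, U')) (g : 'Hom(V, V')) (t : tens U V)
    (x : dual U') :
  tmap f g t x = g (t (x \o f)%VF).
Proof.
rewrite [t in RHS]tens_decomp !sum_lfunE linear_sum.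
by apply: eq_bigr => i _; rewrite !pureE linearZ comp_lfunE.
Qed.

Lemma tflipE U V (t : tens U V) (x : dual U) (y : dual V) :
  x (tflip t y) = y (t x).
Proof.
rewrite [t in RHS]tens_decomp !sum_lfunE !linear_sum.
by apply: eq_bigr => i _; rewrite !pureE !linearZ; exact: mulrC.
Qed.

Lemma tlift_pairl U V (t : tens U V) (x : dual U) :
  tlift (fun u v => (x u : K) *: v) t = t x.
Proof.
by rewrite [t in RHS]tens_decomp sum_lfunE; apply: eq_bigr => i _; rewrite pureE.
Qed.

Lemma tlift_pairr U V (t : tens U V) (y : dual V) :
  tlift (fun u v => (y v : K) *: u) t = tflip t y.
Proof. by rewrite sum_lfunE; apply: eq_bigr => i _; rewrite pureE. Qed.

Lemma r_plus_id (A : vectType K) (r : tens A A) : r_plus r = r.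
Proof.
by apply/lfunP=> x; apply: dual_ext => y; rewrite r_plusE tpairE.
Qed.

Lemma r_minus_flip (A : vectType K) (r : tens A A) : r_minus r = - tflip r.
Proof.
apply/lfunP=> x; apply: dual_ext => y.
by rewrite r_minusE tpairE opp_lfunE linearN /= tflipE.
Qed.

Variable A : vectType K.
Implicit Types (op : bilop A) (r : tens A A) (x y : dual A).

Lemma bilopDl op a b c : op (a + b) c = op a c + op b c.
Proof. by rewrite linearD; apply: add_lfunE. Qed.

Lemma bilopNl op a c : op (- a) c = - op a c.
Proof. by rewrite linearN; apply: opp_lfunE. Qed.

Lemma bilopZl op k a c : op (k *: a) c = k *: op a c.
Proof. by rewrite linearZ; apply: scale_lfunE. Qed.

Lemma endD (f : 'End(A)) a b : f (a + b) = f a + f b.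
Proof. exact: linearD. Qed.

Lemma endN (f : 'End(A)) a : f (- a) = - f a.
Proof. exact: linearN. Qed.

Lemma endZ (f : 'End(A)) k a : f (k *: a) = k *: f a.
Proof. exact: linearZ. Qed.

Lemma bilop_suml op (I : finType) (F : I -> A) c :
  op (\sum_i F i) c = \sum_i op (F i) c.
Proof. by rewrite linear_sum; apply: sum_lfunE. Qed.

Lemma tlift2_eval (F : A -> A -> A -> A -> tens A (tens A A)) r x y :
  tlift (fun a b => tlift (F a b) r) r x y =
  tlift (fun a b => tlift (fun a' b' => F a b a' b' x y) r) r.
Proof.
by rewrite /tlift !sum_lfunE; apply: eq_bigr => i _; rewrite !sum_lfunE.
Qed.

(** Two functionals contract the first two legs of a threefold tensor and leave a vector in the
    third; the three lemmas from here on treat one Yang-Baxter term each. *)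
Lemma tlift_pair13 op r x y :
  tlift (fun a b => tlift (fun a' b' => (op a a' ⊗ (b ⊗ b')) x y) r) r =
  r (x \o op (tflip r y))%VF.
Proof.
(* With the second copy of [r] outermost, the inner sum over the first copy collapses to
   [tflip r y]. *)
rewrite -[RHS]tlift_pairl /tlift exchange_big; apply: eq_bigr => j _ /=.
rewrite comp_lfunE -tlift_pairr /tlift bilop_suml linear_sum scaler_suml.
apply: eq_bigr => i _; rewrite !(pureE, scale_lfunE) scalerA.
by rewrite bilopZl linearZ mulrC.
Qed.

Lemma tlift_pair12 op r x y :
  tlift (fun a b => tlift (fun a' b' => (a ⊗ (a' ⊗ op b b')) x y) r) r =
  op (r x) (r y).
Proof.
rewrite -[r x]tlift_pairl -[r y]tlift_pairl /tlift bilop_suml.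
apply: eq_bigr => i _; rewrite linear_sum; apply: eq_bigr => j _ /=.
by rewrite !(pureE, scale_lfunE) bilopZl endZ scalerA mulrC -scalerA.
Qed.

Lemma tlift_pair23 op r x y :
  tlift (fun a b => tlift (fun a' b' => (a ⊗ (op b a' ⊗ b')) x y) r) r =
  r (y \o op (r x))%VF.
Proof.
rewrite -[RHS]tlift_pairl /tlift exchange_big; apply: eq_bigr => j _ /=.
rewrite comp_lfunE -[r x]tlift_pairl /tlift bilop_suml linear_sum.
rewrite scaler_suml; apply: eq_bigr => i _.
by rewrite !(pureE, scale_lfunE) scalerA bilopZl linearZ.
Qed.

Lemma C_of_eval op r x y : C_of op r x y =
  r (x \o op (tflip r y))%VF + op (r x) (r y) + r (y \o op (r x))%VF.
Proof.
rewrite -tlift_pair13 -tlift_pair12 -tlift_pair23 tlift2_eval /tlift -!big_split.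
apply: eq_bigr => i _; rewrite -!big_split.
by apply: eq_bigr => j _; rewrite !add_lfunE.
Qed.

Lemma A_of_eval op r x y : (forall a b, op a b = op b a) -> A_of op r x y =
  r (x \o op (tflip r y))%VF + op (r x) (r y) - r (y \o op (r x))%VF.
Proof.
move=> opC; rewrite -tlift_pair13 -tlift_pair12 -tlift_pair23 tlift2_eval.
rewrite /tlift -sumrN -!big_split; apply: eq_bigr => i _.
rewrite -sumrN -!big_split; apply: eq_bigr => j _.
(* [A_of] writes its third product as [op a' b], whereas [tlift_pair23] has [op b a']. *)
by rewrite !(add_lfunE, opp_lfunE) [op (r _) (vbasis _)`_j]opC.
Qed.

Lemma dual_evalD (x : dual A) u v : x (u + v) = (x u : K) + x v.
Proof. exact: linearD. Qed.

Lemma dual_evalN (x : dual A) u : x (- u) = - (x u : K).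
Proof. exact: linearN. Qed.

Lemma dual_evalZ (x : dual A) k u : x (k *: u) = k * (x u : K).
Proof. exact: linearZ. Qed.

End Tensors.

(** Expands an evaluated identity until each monomial in the operations and [P] is a scalar atom for
    [ring]. *)
Definition expandE := (bilopDl, bilopNl, bilopZl, endD, endN, endZ,
  dual_evalD, dual_evalN, dual_evalZ).

(** * Poisson identities and descendent operations *)

Section PoissonIdentities.
Variables (K : fieldType) (A : vectType K) (br mul : bilop A).
Hypothesis poi : is_poisson br mul.
Implicit Types (x : dual A) (a b c : A).

Lemma poisson_brC a b : br a b = - br b a.
Proof.
have := poisson_alt poi (a + b).
rewrite !bilopDl !endD !(poisson_alt poi) add0r addr0.
by move/eqP; rewrite addr_eq0 => /eqP.
Qed.

Lemma poisson_jacobi_eval x a b c :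
  x (br a (br b c)) = - (x (br b (br c a)) : K) - x (br c (br a b)).
Proof.
apply/eqP; rewrite -opprD -addr_eq0 -!dual_evalD addrA (poisson_jacobi poi).
by rewrite linear0.
Qed.

Lemma poisson_leibniz_eval x a b c :
  x (br a (mul b c)) = (x (mul (br a b) c) : K) + x (mul b (br a c)).
Proof. by rewrite (poisson_leibniz poi) linearD. Qed.

Lemma poisson_brl a b c : br (br a b) c = br a (br b c) - br b (br a c).
Proof.
rewrite poisson_brC (poisson_brC a c) endN opprK; apply/eqP.
by rewrite eq_sym -addr_eq0 (poisson_jacobi poi).
Qed.

Lemma poisson_leibnizl a b c : br (mul a b) c = mul a (br b c) + mul b (br a c).
Proof.
rewrite poisson_brC (poisson_leibniz poi) opprD addrC !(poisson_brC c) endN.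
by rewrite bilopNl !opprK [mul (br a c) b](poisson_mulC poi).
Qed.

Variables (P : 'End(A)) (lam : K).

(** The Rota-Baxter identity says that [P] is a homomorphism from this operation to [op]. *)
Definition descendent (op : bilop A) a b :=
  op (P a) b + op a (P b) + lam *: op a b.

(** The middle term has [P] on a descendent product, which the Rota-Baxter identity for [op'] turns
    into [op' (P b) (P c)]; thus [P] is left on single letters only. *)
Lemma descendent_descendentr (op op' : bilop A) a b c :
  rota_baxter lam op' P -> descendent op a (descendent op' b c) =
  op (P a) (descendent op' b c) + op a (op' (P b) (P c))
  + lam *: op a (descendent op' b c).
Proof. by move=> ->. Qed.

Lemma descendent_descendentl (op op' : bilop A) a b c :
  rota_baxter lam op' P -> descendent op (descendent op' a b) c =
  op (op' (P a) (P b)) c + op (descendent op' a b) (P c)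
  + lam *: op (descendent op' a b) c.
Proof. by move=> ->. Qed.

Lemma descendent_alt a : descendent br a a = 0.
Proof.
by rewrite /descendent (poisson_brC a) subrr add0r (poisson_alt poi) scaler0.
Qed.

Lemma descendent_mulC a b : descendent mul a b = descendent mul b a.
Proof.
rewrite /descendent ![mul a _](poisson_mulC poi) [mul (P a) b](poisson_mulC poi).
by rewrite [_ + mul (P b) a]addrC.
Qed.

Lemma descendent_jacobi a b c : rota_baxter lam br P ->
  descendent br a (descendent br b c) + descendent br b (descendent br c a)
  + descendent br c (descendent br a b) = 0.
Proof.
move=> rb; apply: dual_ext => x; rewrite !descendent_descendentr // /descendent.
rewrite !expandE.
pose J := poisson_jacobi_eval x.
(* One Jacobi identity for each placement of [P] on the letters, except on all three: every term
   keeps a bare letter. *)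
rewrite (J (P a) (P b) c) (J (P a) b (P c)) (J (P a) b c) (J a (P b) (P c)).
by rewrite (J a (P b) c) (J a b (P c)) (J a b c) linear0; ring.
Qed.

Lemma descendent_mulA a b c : rota_baxter lam mul P ->
  descendent mul a (descendent mul b c) = descendent mul (descendent mul a b) c.
Proof.
move=> rb; apply: dual_ext => x.
rewrite descendent_descendentr // descendent_descendentl // /descendent.
by rewrite !expandE !(poisson_mulA poi); ring.
Qed.

Lemma descendent_leibniz a b c : rota_baxter lam br P -> rota_baxter lam mul P ->
  descendent br a (descendent mul b c) =
  descendent mul (descendent br a b) c + descendent mul b (descendent br a c).
Proof.
move=> rb rm; apply: dual_ext => x.
rewrite !descendent_descendentr // descendent_descendentl // /descendent.
by rewrite !expandE !poisson_leibniz_eval; ring.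
Qed.

End PoissonIdentities.

(** * The tensor of a Rota-Baxter operator on a quadratic Poisson algebra *)

Section QuadraticRotaBaxter.
Variables (K : fieldType) (A : vectType K) (br mul : bilop A) (B : bilform A).
Variables (P : 'End(A)) (lam : K).
Hypothesis qrb : quadratic_rota_baxter_poisson br mul B P lam.

Let poi : is_poisson br mul := qrb_poisson qrb.
Let brC := poisson_brC poi.
Let mulC := poisson_mulC poi.

(** Allows identities of tensors to be tested on arguments [B a] only. *)
Lemma form_surj (x : dual A) : exists a, x = B a.
Proof.
have [_ cB] := form_isoP (qrb_nondeg qrb).
by exists (form_iso B x); rewrite cB.
Qed.

(** By invariance and antisymmetry, [br c] is skew-adjoint for [B]; in [form_mul], commutativity
    makes [mul c] self-adjoint. *)
Lemma form_br a c : (B a \o br c)%VF = - B (br c a).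
Proof.
apply/lfunP=> d; rewrite comp_lfunE opp_lfunE -(qrb_inv_br qrb) brC.
by rewrite linearN opp_lfunE.
Qed.

Lemma form_mul a c : (B a \o mul c)%VF = B (mul c a).
Proof. by apply/lfunP=> d; rewrite comp_lfunE -(qrb_inv_mul qrb) mulC. Qed.

Lemma form_P a b : B a (P b) = - (B (P a + lam *: a) b : K).
Proof.
apply/eqP; rewrite -addr_eq0 linearD linearZ add_lfunE scale_lfunE addrA.
by rewrite (qrb_compat qrb).
Qed.

Variable r : tens A A.
Hypothesis rP : forall x y : dual A,
  tpair r (x ⊗ y) = y ((P \o form_iso B)%VF x).

Lemma tensor_form a : r (B a) = P a.
Proof.
have [Bc _] := form_isoP (qrb_nondeg qrb).
by apply: dual_ext => y; rewrite -tpairE rP comp_lfunE Bc.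
Qed.

Lemma tflip_form a : tflip r (B a) = - (P a + lam *: a).
Proof.
apply: dual_ext => x; have [b ->] := form_surj x.
by rewrite tflipE tensor_form linearN /= form_P (qrb_sym qrb).
Qed.

Lemma sym_form a : (r + tflip r) (B a) = - lam *: a.
Proof.
by rewrite add_lfunE tensor_form tflip_form opprD addrA subrr add0r scaleNr.
Qed.

Lemma tmap_br_form (t : tens A A) c a :
  tmap (br c) \1%VF t (B a) = - t (B (br c a)).
Proof. by rewrite tmapE form_br id_lfunE linearN. Qed.

Lemma tmap_mul_form (t : tens A A) c a :
  tmap (mul c) \1%VF t (B a) = t (B (mul c a)).
Proof. by rewrite tmapE form_mul id_lfunE. Qed.

Lemma tmap_id_form (op : bilop A) (t : tens A A) c a :
  tmap \1%VF (op c) t (B a) = op c (t (B a)).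
Proof. by rewrite tmapE comp_lfun1r. Qed.

(** Skew-adjointness of [br c] turns the sum in [delta_of] into a commutator with [P]; for the
    self-adjoint [mul c] the sign is already in [Delta_of]. *)
Lemma delta_form c a :
  delta_of br r c (B a) = br c (P a) - P (br c a).
Proof.
by rewrite delta_ofE add_lfunE tmap_id_form tmap_br_form !tensor_form.
Qed.

Lemma Delta_form c a :
  Delta_of mul r c (B a) = mul c (P a) - P (mul c a).
Proof.
by rewrite Delta_ofE add_lfunE opp_lfunE tmap_id_form tmap_mul_form !tensor_form.
Qed.

Lemma form_addl a b c : B (a + b) c = (B a c : K) + B b c.
Proof. by rewrite linearD; apply: add_lfunE. Qed.

(** Invariance and symmetry of [B] make [B (op a b) c] cyclic, for bracket and product alike. *)
Lemma form_rotate (op : bilop A) a b c :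
  (forall a b c, B (op a b) c = B a (op b c)) -> B b (op c a) = B (op a b) c.
Proof. by move=> inv; rewrite inv -(inv b) (qrb_sym qrb). Qed.

(** Rotation sends the first term to [op (P a) b] and, once [form_P] has moved [P] across [B], the
    second to [op a (P b + lam *: b)]. *)
Lemma form_descendent (op : bilop A) a b c :
  (forall a b c, B (op a b) c = B a (op b c)) ->
  B b (op c (P a) - P (op c a)) = B (descendent P lam op a b) c.
Proof.
move=> inv; rewrite !(dual_evalD, dual_evalN) form_P opprK !form_rotate //.
by rewrite -form_addl /descendent endD endZ addrA.
Qed.

Lemma dual_op_delta_form a b :
  dual_op (delta_of br r) (B a) (B b) = B (descendent P lam br a b).
Proof.
apply/lfunP => c; rewrite dual_opE tpairE delta_form form_descendent //.
exact: qrb_inv_br qrb.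
Qed.

Lemma dual_op_Delta_form a b :
  dual_op (Delta_of mul r) (B a) (B b) = B (descendent P lam mul a b).
Proof.
apply/lfunP => c; rewrite dual_opE tpairE Delta_form form_descendent //.
exact: qrb_inv_mul qrb.
Qed.

Lemma dual_poisson :
  is_poisson (dual_op (delta_of br r)) (dual_op (Delta_of mul r)).
Proof.
have dE := dual_op_delta_form; have DE := dual_op_Delta_form.
have rb := qrb_rb_br qrb; have rm := qrb_rb_mul qrb.
split=> [x|x y z|x y|x y z|x y z]; have [a ->] := form_surj x;
  try (have [b ->] := form_surj y); try (have [c ->] := form_surj z).
- by rewrite dE (descendent_alt poi) linear0.
- by rewrite !dE -!linearD (descendent_jacobi poi) ?linear0.
- by rewrite !DE (descendent_mulC poi).
- by rewrite !DE (descendent_mulA poi).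
- by rewrite !(dE, DE) -linearD (descendent_leibniz poi).
Qed.

(** At [B a] and [B b] both equations read [op (P a) (P b) - P (descendent P lam op a b) = 0], with
    [op] the bracket or the product. *)
Lemma tensor_YBE : poisson_YBE br mul r.
Proof.
split; apply/lfunP => x; rewrite zero_lfunE; apply/lfunP => y;
  rewrite zero_lfunE; have [a ->] := form_surj x; have [b ->] := form_surj y.
- rewrite C_of_eval !tensor_form !tflip_form !form_br !(linearN r) /=.
  rewrite !tensor_form (qrb_rb_br qrb).
  by apply: dual_ext => z; rewrite !(brC _ a) !expandE linear0; ring.
- rewrite A_of_eval // !tensor_form !tflip_form !form_mul /= !tensor_form.
  rewrite (qrb_rb_mul qrb) !(mulC _ a).
  by apply: dual_ext => z; rewrite !expandE linear0; ring.
Qed.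

Lemma tensor_bialgebra :
  is_poisson_bialgebra br mul (delta_of br r) (Delta_of mul r).
Proof.
have formE := (tmap_br_form, tmap_mul_form, tmap_id_form, delta_form,
  Delta_form).
split=> // [|a b|a b|a b|a b]; first exact: dual_poisson.
all: apply/lfunP=> x; have [c ->] := form_surj x; apply: dual_ext => y.
all: rewrite !(add_lfunE, opp_lfunE, formE).
(* [br (br a b)] is the commutator of [br a] and [br b], so this is the Jacobi identity for
   commutators of endomorphisms. *)
- by rewrite !(poisson_brl poi) !expandE; ring.
(* The terms [mul b (P (mul a c))] cancel; the others agree in this normal form. *)
- have mulCA u : mul b (mul a u) = mul (mul a b) u.
    by rewrite (poisson_mulA poi) (mulC b).
  by rewrite !(endD, endN) !mulCA !expandE; ring.
- rewrite !(poisson_leibnizl poi) !(endD, endN) !(poisson_leibniz poi).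
  (* The terms with factors [br a b] and [br b a] cancel by antisymmetry. *)
  by rewrite (brC b a) !expandE; ring.
- by rewrite !(endD, endN) !(poisson_leibniz poi) !expandE; ring.
Qed.

(** Read through [B], invariance means commuting with all [br a] and [mul a], as a multiple of the
    identity does. *)
Lemma sym_part_invariant : ad_L_invariant br mul (sym_part r).
Proof.
split; apply/lfunP=> x; rewrite zero_lfunE; have [c ->] := form_surj x;
  rewrite !(add_lfunE, opp_lfunE, tmap_br_form, tmap_mul_form, tmap_id_form)
    !(scale_lfunE, sym_form) !endZ; [exact: addNr | exact: subrr].
Qed.

Lemma r_plus_minus_bij : lam != 0 -> bijective (r_plus r - r_minus r).
Proof.
move=> lam0; have [BK IK] := form_isoP (qrb_nondeg qrb).
rewrite r_plus_id r_minus_flip opprK.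
(* By [sym_form], the map composed with [B] is multiplication by [- lam], which is invertible as the
   weight is nonzero. *)
exists (fun a => B (- lam^-1 *: a)) => [x|a].
  have [a ->] := form_surj x; rewrite sym_form scalerA mulrNN mulVf //.
  by rewrite scale1r.
by rewrite sym_form scalerA mulrNN mulfV // scale1r.
Qed.

End QuadraticRotaBaxter.

Theorem theorem4p9 (K : fieldType) (charK : [pchar K] =i pred0)
    (A : vectType K) (br mul : bilop A) (B : bilform A) (P : 'End(A)) (lam : K)
    (r : tens A A) :
  lam != 0 ->
  quadratic_rota_baxter_poisson br mul B P lam ->
  (forall x y : dual A, tpair r (x ⊗ y) = y ((P \o form_iso B)%VF x)) ->
  poisson_YBE br mul r /\ factorizable br mul r.
Proof.
move=> lam0 qrb rP; have ybe := tensor_YBE qrb rP.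
split=> //; split; last exact: (r_plus_minus_bij qrb rP).
split=> //; first exact: (tensor_bialgebra qrb rP).
exact: (sym_part_invariant qrb rP).
Qed.
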